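(* For every $\varepsilon>0$ there exist $c>0$ and $\delta_0$ such that the following holds. Let $G$ be a graph with minimum degree $\delta\ge\delta_0$ and maximum degree $\Delta\le e^{c\delta}$, and let $F:V(G)\to 2^{\mathbb N}$. If $|F(v)|\le(\sqrt2-1-\varepsilon)\deg_G(v)$ for each $v\in V(G)$, then $G$ has an $F$-avoiding orientation. (Informally: if $\Delta=e^{o(\delta)}$ and $|F(v)|\le(\sqrt2-1-o(1))\deg_G(v)$ for all $v$, where $o(1)\to0$ as $\delta\to\infty$ at a rate depending on how fast $\delta$ dominates $\log\Delta$, then $G$ has an $F$-avoiding orientation.)
   Context: Given $F:V(G)\to 2^{\mathbb N}$, an orientation $D$ of $G$ is $F$-avoiding if the out-degree $\deg^+_D(v)\notin F(v)$ for every $v\in V(G)$. *)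

(* Defs.v *)
From HB Require Import structures.
From mathcomp Require Import all_boot all_order all_algebra.
From mathcomp Require Import finmap.
From mathcomp Require Import boolp classical_sets functions cardinality.
From mathcomp Require Import reals topology normedtype sequences exp.

Set Implicit Arguments.
Unset Strict Implicit.
Unset Printing Implicit Defensive.

Import Order.TTheory GRing.Theory Num.Theory.

Definition simple_graph (V : finType) (G : rel V) : Prop :=
  symmetric G /\ irreflexive G.

Definition deg (V : finType) (G : rel V) (v : V) : nat := #|G v|.

(* The default value #|V| only matters when V is empty: in a loopless graph
   every degree is smaller than #|V|. *)
Definition min_deg (V : finType) (G : rel V) : nat :=
  \big[minn/#|V|]_(v : V) deg G v.

Definition max_deg (V : finType) (G : rel V) : nat :=
  \max_(v : V) deg G v.

(* D u v means that the edge uv is directed from u to v. *)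
Definition orientation (V : finType) (G D : rel V) : Prop :=
  (forall u v, G u v = D u v || D v u) /\
  (forall u v, ~~ (D u v && D v u)).

Definition outdeg (V : finType) (D : rel V) (v : V) : nat := #|D v|.

Definition avoiding (V : finType) (F : V -> set nat) (D : rel V) : Prop :=
  forall v, ~ F v (outdeg D v).

(* Main.v *)
(* Order the vertices and let each vertex v concede some of its edges to earlier
   vertices, j(v) in number; let c(v) be the number of edges conceded to v and
   b(v) its number of earlier neighbours.  If |F(v)| <= c(v) or
   |F(v)| + 2 j(v) <= c(v) + b(v) for every v, then an F-avoiding orientation
   exists.  By the Combinatorial Nullstellensatz it is enough that
   prod_v (sum of +-x_e over e at v)^|F(v)| is nonzero in Z[x_e]/(x_e^2).
   Eliminate the last vertex v: modulo x_e^2 the other factors are linear in the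
   b variables of the edges at v, and multiplication by the m-th power of the
   sum of these variables is injective in degree j when 2j + m <= b (hard
   Lefschetz for (P^1)^b), so the coefficient of the product of the j conceded
   edges, which is the same problem on the remaining vertices, survives.

   For the concessions, give each vertex a random type; as Delta <= e^(c delta),
   the local lemma makes all neighbourhoods nearly equidistributed among types.
   Think of types as points of [0, 1], with a = sqrt 2 - 1.  Types t <= a receive
   every edge from later types below a, and a type z = a + (1 - a) w > a concedes
   to t = a x exactly when w + x >= 1, with density 1 / sqrt 2.  Since
   1 - a = sqrt 2 a, this gives c(t) = (a - t) + t = a, while
   j(z) = (z - a) / 2 = (b(z) - a) / 2. *)

Require Import Defs.
From HB Require Import structures.
From mathcomp Require Import all_boot all_order all_algebra.
From mathcomp Require Import finmap.
From mathcomp Require Import boolp classical_sets functions cardinality.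
From mathcomp Require Import reals topology normedtype sequences exp.
(* Imported again so that set0, setU, subsetP and the like denote the operations
   on {set T} rather than those of classical_sets. *)
From mathcomp Require Import fintype finset.
From mathcomp Require Import zify ring lra.

Set Implicit Arguments.
Unset Strict Implicit.
Unset Printing Implicit Defensive.

Import Order.TTheory GRing.Theory Num.Theory.
Local Open Scope fset_scope.
Local Open Scope ring_scope.

(** * The square-free algebra *)

(* Z[x_e]/(x_e^2): f S is the coefficient of the product of the x_e, e in S. *)
Definition sqalg (E : finType) : Type := {ffun {set E} -> int}.
HB.instance Definition _ (E : finType) := GRing.Zmodule.on (sqalg E).

Section SquareFreeAlgebra.
Variable E : finType.
Implicit Types (f g : sqalg E) (S T : {set E}) (e : E).

Definition sq_mul f g : sqalg E :=
  [ffun S : {set E} => \sum_(T : {set E} | T \subset S) f T * g (S :\: T)].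
Definition sq_one : sqalg E := [ffun S : {set E} => (S == set0)%:R].

Lemma sq_mulA : associative sq_mul.
Proof.
move=> f g h; apply/ffunP => S; rewrite !ffunE.
under eq_bigr => T _ do rewrite ffunE mulr_sumr.
under [RHS]eq_bigr => T _ do rewrite ffunE mulr_suml.
rewrite [RHS](exchange_big_dep (fun T => T \subset S)) /=; last first.
  by move=> T U TS UT; apply: subset_trans UT TS.
apply: eq_bigr => T TS.
rewrite [RHS](reindex_onto (fun U => U :|: T) (fun U => U :\: T)) /=; last first.
  by move=> U /andP[_ TU]; rewrite setDE setUIl [~: T :|: T]setUC setUCr setIT (setUidPl TU).
apply: eq_big => U.
  rewrite subsetD subUset TS andbT subsetUr andbT; congr (_ && _).
  rewrite setDUl setDv setU0; apply/idP/eqP.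
    by move/setDidPl.
  by move/setDidPl.
rewrite subsetD => /andP[US dUT].
have -> : (U :|: T) :\: T = U by rewrite setDUl setDv setU0; apply/setDidPl.
by rewrite mulrA setUC setDDl.
Qed.

Lemma sq_mulC : commutative sq_mul.
Proof.
move=> f g; apply/ffunP => S; rewrite !ffunE.
rewrite (reindex_onto (fun U => S :\: U) (fun U => S :\: U)) /=; last first.
  by move=> U US; rewrite setDDr setDv set0U; apply/setIidPr.
apply: eq_big => U.
  rewrite subsetDl /= setDDr setDv set0U; apply/eqP/idP => [<-|]; first exact: subsetIl.
  by move/setIidPr.
by move=> /andP[_ /eqP ->]; rewrite mulrC.
Qed.

Lemma sq_mul1 : left_id sq_one sq_mul.
Proof.
move=> f; apply/ffunP => S; rewrite ffunE (bigD1 set0) ?sub0set //= ffunE eqxx mul1r setD0.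
by rewrite big1 ?addr0 // => T /andP[_ /negbTE nT]; rewrite ffunE nT mul0r.
Qed.

Lemma sq_mulDl : left_distributive sq_mul +%R.
Proof.
move=> f g h; apply/ffunP => S; rewrite !ffunE -big_split /=.
by apply: eq_bigr => T _; rewrite !ffunE mulrDl.
Qed.

Lemma sq_one_neq0 : sq_one != 0.
Proof. by apply/eqP => /ffunP /(_ set0); rewrite !ffunE eqxx. Qed.

HB.instance Definition _ := GRing.Zmodule_isComNzRing.Build (sqalg E)
  sq_mulA sq_mulC sq_mul1 sq_mulDl sq_one_neq0.

Lemma sq_mulE f g S :
  (f * g) S = \sum_(T : {set E} | T \subset S) f T * g (S :\: T).
Proof. by rewrite ffunE. Qed.

Lemma sq_addE f g S : (f + g) S = f S + g S.
Proof. by rewrite ffunE. Qed.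

Lemma sq_oppE f S : (- f) S = - f S.
Proof. by rewrite ffunE. Qed.

Lemma sq_0E S : (0 : sqalg E) S = 0.
Proof. by rewrite ffunE. Qed.

Lemma sq_1E S : (1 : sqalg E) S = (S == set0)%:R.
Proof. by rewrite ffunE. Qed.

Lemma sq_mulrnE f n S : (f *+ n) S = f S *+ n.
Proof. by elim: n => [|n IH]; rewrite ?mulr0n ?sq_0E // !mulrS sq_addE IH. Qed.

Lemma sq_sumE (I : Type) (r : seq I) (P : pred I) (F : I -> sqalg E) S :
  (\sum_(i <- r | P i) F i) S = \sum_(i <- r | P i) F i S.
Proof.
by elim/big_rec2: _ => [|i y z _ <-]; rewrite ?sq_0E ?sq_addE.
Qed.

Lemma sq_mulrn_eq0 f n : (f *+ n.+1 == 0) = (f == 0).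
Proof.
apply/eqP/eqP => [f0|->]; last by rewrite mul0rn.
apply/ffunP => S; move/ffunP: f0 => /(_ S); rewrite sq_mulrnE !sq_0E => /eqP.
by rewrite mulrn_eq0 /= => /eqP.
Qed.

Definition sq_var e : sqalg E := [ffun S : {set E} => (S == [set e])%:R].

Lemma sq_var_mulE e f S :
  (sq_var e * f) S = if e \in S then f (S :\ e) else 0.
Proof.
rewrite sq_mulE; case: ifP => eS.
  rewrite (bigD1 [set e]) ?sub1set //= ffunE eqxx mul1r big1 ?addr0 //.
  by move=> T /andP[_ /negbTE nT]; rewrite ffunE nT mul0r.
rewrite big1 // => T TS; rewrite ffunE; case: eqP => [TE|_]; last by rewrite mul0r.
by move: TS; rewrite TE sub1set eS.
Qed.

Lemma sq_var_sqr e : sq_var e * sq_var e = 0.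
Proof.
apply/ffunP => S; rewrite sq_var_mulE sq_0E; case: ifP => // eS.
rewrite ffunE; case: eqP => // /setP /(_ e).
by rewrite !inE eqxx.
Qed.

Lemma sq_exp_addv e f n :
  (f + sq_var e) ^+ n.+1 = f ^+ n.+1 + sq_var e * f ^+ n *+ n.+1.
Proof.
have x2 := sq_var_sqr e; set x := sq_var e in x2 *.
elim: n => [|n IH]; first by rewrite !expr1 expr0 mulr1.
rewrite exprS IH !(exprS f); set a := f ^+ n.
have -> : (f + x) * (f * a + x * a *+ n.+1)
  = f * (f * a) + x * (f * a) *+ n.+2 + (x * x) * (a *+ n.+1) by ring.
by rewrite x2 mul0r addr0.
Qed.

(** * Expansion in a single variable *)

Definition var_free e f := forall S, e \in S -> f S = 0.

Lemma var_free1 e : var_free e 1.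
Proof.
move=> S eS; rewrite sq_1E; case: eqP => // S0.
by move: eS; rewrite S0 inE.
Qed.

Lemma var_free0 e : var_free e 0.
Proof. by move=> S eS; rewrite sq_0E. Qed.

Lemma var_freeD e f g : var_free e f -> var_free e g -> var_free e (f + g).
Proof. by move=> hf hg S eS; rewrite sq_addE hf // hg. Qed.

Lemma var_freeN e f : var_free e f -> var_free e (- f).
Proof. by move=> hf S eS; rewrite sq_oppE hf // oppr0. Qed.

Lemma var_freeM e f g : var_free e f -> var_free e g -> var_free e (f * g).
Proof.
move=> hf hg S eS; rewrite sq_mulE big1 // => T TS.
case: (boolP (e \in T)) => eT; first by rewrite hf // mul0r.
by rewrite hg ?mulr0 // inE eT eS.
Qed.

Lemma var_freeMn e f n : var_free e f -> var_free e (f *+ n).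
Proof. by move=> hf S eS; rewrite sq_mulrnE hf // mul0rn. Qed.

Lemma var_freeX e f n : var_free e f -> var_free e (f ^+ n).
Proof.
by move=> hf; elim: n => [|n IH]; rewrite ?exprS; [exact: var_free1|exact: var_freeM].
Qed.

Lemma var_free_sum e (I : Type) (r : seq I) (P : pred I) (F : I -> sqalg E) :
  (forall i, P i -> var_free e (F i)) -> var_free e (\sum_(i <- r | P i) F i).
Proof.
move=> hF; elim/big_ind: _ => //; [exact: var_free0|exact: var_freeD].
Qed.

Lemma var_free_prod e (I : Type) (r : seq I) (P : pred I) (F : I -> sqalg E) :
  (forall i, P i -> var_free e (F i)) -> var_free e (\prod_(i <- r | P i) F i).
Proof.
move=> hF; elim/big_ind: _ => //; [exact: var_free1|exact: var_freeM].
Qed.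

Lemma var_free_var e e' : e != e' -> var_free e (sq_var e').
Proof.
move=> ne S eS; rewrite ffunE; case: eqP => // SE.
by move: eS; rewrite SE inE (negbTE ne).
Qed.

Lemma var_free_addv_eq0 e f g : var_free e f -> var_free e g ->
  f + sq_var e * g = 0 -> f = 0 /\ g = 0.
Proof.
move=> hf hg fg0.
have f0 : f = 0.
  apply/ffunP => S; rewrite sq_0E; case: (boolP (e \in S)) => eS; first exact: hf.
  move/ffunP: fg0 => /(_ S).
  by rewrite sq_addE sq_var_mulE (negbTE eS) addr0 sq_0E.
split=> //; apply/ffunP => S; rewrite sq_0E.
case: (boolP (e \in S)) => eS; first exact: hg.
move/ffunP: fg0 => /(_ (e |: S)); rewrite f0 add0r sq_var_mulE setU11 sq_0E.
by rewrite setU1K.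
Qed.

Definition var_rest e f : sqalg E := [ffun S : {set E} => if e \in S then 0 else f S].
Definition var_coef e f : sqalg E := [ffun S : {set E} => if e \in S then 0 else f (e |: S)].

Lemma var_rest_free e f : var_free e (var_rest e f).
Proof. by move=> S eS; rewrite ffunE eS. Qed.

Lemma var_coef_free e f : var_free e (var_coef e f).
Proof. by move=> S eS; rewrite ffunE eS. Qed.

Lemma var_decomp e f : f = var_rest e f + sq_var e * var_coef e f.
Proof.
apply/ffunP => S; rewrite sq_addE sq_var_mulE !ffunE !inE.
by case: (boolP (e \in S)) => eS; rewrite ?addr0 // add0r eqxx /= setD1K.
Qed.

(** Only the variables in [N] count towards the degree; all others act as coefficients. *)
Definition homog (N : seq E) k f :=
  forall S, count (mem S) N != k -> f S = 0.

Lemma count_setU1_notin e S (N : seq E) : e \notin N ->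
  count (mem (e |: S)) N = count (mem S) N.
Proof.
move=> eN; apply: eq_in_count => x xN; rewrite /= !inE.
by case: eqP => // xe; rewrite xe (negbTE eN) in xN.
Qed.

Lemma count_setD1_notin e S (N : seq E) : e \notin N ->
  count (mem (S :\ e)) N = count (mem S) N.
Proof.
move=> eN; apply: eq_in_count => x xN; rewrite /= !inE.
by case: eqP => // xe; rewrite xe (negbTE eN) in xN.
Qed.

(* The hard Lefschetz property of the cohomology of (P^1)^N: multiplication by
   a power of the sum of the variables of N is injective below the middle
   degree. *)
Lemma sum_vars_exp_inj (N : seq E) j m f : uniq N ->
  (2 * j + m <= size N)%N -> homog N j f ->
  (\sum_(e <- N) sq_var e) ^+ m * f = 0 -> f = 0.
Proof.
elim: N j m f => [|e N IH] j [|m] f /=; rewrite ?expr0 ?mul1r // ?addn0.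
  by rewrite addnS ltn0.
case/andP=> eN uN; rewrite addnS ltnS => le_d hom.
rewrite big_cons addrC; set s := \sum_(e <- N) _.
have sfree : var_free e s.
  rewrite /s big_seq; apply: var_free_sum => x xN; apply: var_free_var.
  by apply: contraNneq eN => ->.
set p := var_rest e f; set q := var_coef e f.
have pfree : var_free e p := @var_rest_free e f.
have qfree : var_free e q := @var_coef_free e f.
rewrite [X in _ * X](var_decomp e) -/p -/q sq_exp_addv.
have -> : (s ^+ m.+1 + sq_var e * s ^+ m *+ m.+1) * (p + sq_var e * q)
  = s ^+ m.+1 * p + sq_var e * (s ^+ m.+1 * q + s ^+ m * p *+ m.+1)
    + (sq_var e * sq_var e) * (s ^+ m * q *+ m.+1) by ring.
rewrite sq_var_sqr mul0r addr0 => /var_free_addv_eq0.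
case; [exact: var_freeM (var_freeX _ _) _| |move=> sp sq].
  by apply: var_freeD; [|apply: var_freeMn]; apply: var_freeM => //; apply: var_freeX.
have homp : homog N j p.
  move=> S; rewrite ffunE; case: ifP => // eS nj; apply: hom => /=.
  by rewrite eS.
(* Multiplying the coefficient of x_e by s removes its p term, as s^(m+1) p = 0. Since q has degree
   j - 1 and 2(j - 1) + (m + 2) = 2j + m, induction applies to q with exponent m + 2. *)
have sq' : s ^+ m.+2 * q = 0.
  have : s * (s ^+ m.+1 * q + s ^+ m * p *+ m.+1) = 0 by rewrite sq mulr0.
  by rewrite mulrDr mulrA -exprS -mulrnAl mulrA mulrnAr -exprS mulrnAl sp mul0rn addr0.
have q0 : q = 0.
  case: j le_d hom homp => [|j] le_d hom homp.
    apply/ffunP => S; rewrite !ffunE; case: ifP => // eS; apply: hom.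
    by rewrite /= setU11.
  apply: (IH j m.+2) => //; first by lia.
  move=> S nj; rewrite ffunE; case: ifP => // eS; apply: hom.
  by rewrite /= setU11 count_setU1_notin // add1n eqSS.
move: sq; rewrite q0 mulr0 add0r => /eqP; rewrite sq_mulrn_eq0 => /eqP smp.
have p0 : p = 0 by apply: (IH j m).
by rewrite (var_decomp e f) -/p -/q p0 q0 mulr0 addr0.
Qed.

(** Each variable of [N] occurs only in its own factor, so the monomial of [J] takes [Q e] from the
    factors with [J e] and [P e] from the others. *)
Lemma prod_coef (N : seq E) (P Q : E -> sqalg E) (J : pred E) r S : uniq N ->
  (forall e, e \in N -> var_free e r) ->
  (forall e e', e \in N -> e' \in N -> var_free e (P e') /\ var_free e (Q e')) ->
  (forall e, e \in N -> e \notin S) ->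
  (r * \prod_(e <- N) (P e + sq_var e * Q e)) (S :|: [set e in N | J e])
  = (r * \prod_(e <- N) (if J e then Q e else P e)) S.
Proof.
elim: N r S => [|e N IH] r S.
  move=> _ _ _ _; rewrite !big_nil; congr ((_ : sqalg E) _).
  by apply/setP => x; rewrite !inE andFb orbF.
case/andP=> eN uN hr hPQ hS; rewrite !big_cons.
have sub x : x \in N -> x \in e :: N by rewrite inE orbC => ->.
have ein : e \in e :: N by rewrite mem_head.
have hD : [set x in e :: N | J x] = (if J e then [set e] else set0) :|: [set x in N | J x].
  apply/setP => x; rewrite !inE; case: eqP => [->|/eqP nxe]; case: ifP => Je;
    rewrite ?inE ?eqxx ?(negbTE nxe) ?(negbTE eN) //.
have free' x : x \in N -> var_free x (r * (P e + sq_var e * Q e)).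
  move=> xN; apply: var_freeM; first by apply: hr; apply: sub.
  have [Px Qx] := hPQ x e (sub x xN) ein.
  apply: var_freeD => //; apply: var_freeM => //; apply: var_free_var.
  by apply: contraNneq eN => <-.
have hS' x : x \in N -> x \notin S :|: (if J e then [set e] else set0).
  move=> xN; rewrite inE negb_or hS ?sub //=; case: ifP => _; rewrite !inE //.
  by apply: contraNneq eN => <-.
rewrite hD setUA mulrA (IH _ _ uN free' _ hS'); last first.
  by move=> x y xN yN; apply: hPQ; apply: sub.
set W := \prod_(x <- N) _.
have Wfree : var_free e W.
  rewrite /W big_seq; apply: var_free_prod => x xN.
  have [Px Qx] := hPQ e x ein (sub x xN); by case: ifP.
have [Pe Qe] := hPQ e e ein ein.
have re := hr e ein.
have -> : r * (P e + sq_var e * Q e) * W = r * P e * W + sq_var e * (r * Q e * W) by ring.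
have eS := hS e ein.
rewrite sq_addE sq_var_mulE mulrA; case: ifP => Je.
  rewrite inE set11 orbT (var_freeM (var_freeM re Pe) Wfree) ?add0r; last by rewrite !inE eqxx orbT.
  by rewrite setUC setU1K.
by rewrite setU0 (negbTE eS) addr0.
Qed.

Definition hcomp (N : seq E) k f : sqalg E :=
  [ffun S : {set E} => if count (mem S) N == k then f S else 0].

Lemma hcompE (N : seq E) k f S :
  hcomp N k f S = if count (mem S) N == k then f S else 0.
Proof. by rewrite ffunE. Qed.

Lemma hcomp_var (N : seq E) k e f : uniq N -> e \in N ->
  sq_var e * hcomp N k f = hcomp N k.+1 (sq_var e * f).
Proof.
move=> uN eN; apply/ffunP => S; rewrite sq_var_mulE !hcompE sq_var_mulE.
case: ifP => eS; last by case: ifP.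
have cnt : count (mem S) N = (count (mem (S :\ e)) N).+1.
  have /permP cN := perm_to_rem eN; rewrite !cN /= eS !inE eqxx /= add1n add0n.
  by rewrite count_setD1_notin // mem_rem_uniq // !inE eqxx.
by rewrite cnt eqSS.
Qed.

Lemma hcomp_sum_exp (N : seq E) k m f : uniq N ->
  (\sum_(e <- N) sq_var e) ^+ m * hcomp N k f
  = hcomp N (k + m)%N ((\sum_(e <- N) sq_var e) ^+ m * f).
Proof.
move=> uN; elim: m => [|m IH]; first by rewrite addn0 !expr0 !mul1r.
rewrite !exprS -!mulrA IH addnS !mulr_suml big_seq.
under eq_bigr => e eN do rewrite hcomp_var //.
rewrite -big_seq; apply/ffunP => S; rewrite sq_sumE hcompE.
under eq_bigr => e _ do rewrite hcompE.
by case: ifP => _; [rewrite sq_sumE|rewrite big1].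
Qed.

(** If the last product were zero, so would be its component of degree [count J N + m]. Injectivity
    of the power then kills the component of degree [count J N] of the product without the power,
    and with it the coefficient of the monomial of [J]. For m = 0 there is no power to cancel. *)
Lemma elim_vars (N : seq E) (P Q : E -> sqalg E) (J : pred E) r m : uniq N ->
  (forall e, e \in N -> var_free e r) ->
  (forall e e', e \in N -> e' \in N -> var_free e (P e') /\ var_free e (Q e')) ->
  (m = 0)%N \/ (2 * count J N + m <= size N)%N ->
  r * \prod_(e <- N) (if J e then Q e else P e) != 0 ->
  (\sum_(e <- N) sq_var e) ^+ m * (r * \prod_(e <- N) (P e + sq_var e * Q e)) != 0.
Proof.
move=> uN hr hPQ hm; apply: contra_neq => /(congr1 (hcomp N (count J N + m)%N)).
rewrite -hcomp_sum_exp //; set th := r * _ => hth.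
have th0 : hcomp N (count J N) th = 0.
  have h0 : (\sum_(e <- N) sq_var e) ^+ m * hcomp N (count J N) th = 0.
    by rewrite hth; apply/ffunP => S; rewrite hcompE sq_0E if_same.
  case: hm => hm; first by move: h0; rewrite hm expr0 mul1r.
  apply: sum_vars_exp_inj h0; rewrite //; first exact: hm.
  by move=> S; rewrite hcompE => /negbTE ->.
apply/ffunP => S; rewrite sq_0E.
have [hS|] := boolP (all (fun e => e \notin S) N); last first.
  rewrite -has_predC => /hasP[e eN /=]; rewrite negbK => eS.
  have: var_free e (r * \prod_(e <- N) (if J e then Q e else P e)).
    rewrite big_seq; apply: var_freeM (hr e eN) _; apply: var_free_prod => x xN.
    by have [Px Qx] := hPQ e x eN xN; case: ifP.
  exact.
move/allP: hS => hS; rewrite -(prod_coef J uN hr hPQ hS) -/th.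
move/ffunP: th0 => /(_ (S :|: [set e in N | J e])); rewrite hcompE sq_0E.
case: eqP => // [[]]; apply: eq_in_count => e eN.
by rewrite /= !inE (negbTE (hS e eN)) eN.
Qed.

(** * The Combinatorial Nullstellensatz on the cube *)

(* The coefficient of the monomial of S in the multilinear expansion of h. *)
Definition mobius (h : {set E} -> int) S : int :=
  \sum_(T : {set E} | T \subset S) (-1) ^+ #|S :\: T| * h T.

(** Together with [homogT k f], this says that [h] has degree at most k and that [f] is its part of
    degree k. *)
Definition lead k (h : {set E} -> int) f :=
  forall S, (k <= #|S|)%N -> mobius h S = f S.

Lemma leadD k h1 h2 f1 f2 : lead k h1 f1 -> lead k h2 f2 ->
  lead k (fun T => h1 T + h2 T) (f1 + f2).
Proof.
move=> l1 l2 S kS; rewrite sq_addE -l1 // -l2 // -big_split /=.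
by apply: eq_bigr => T _; rewrite mulrDr.
Qed.

Lemma leadN k h f : lead k h f -> lead k (fun T => - h T) (- f).
Proof.
move=> l S kS; rewrite sq_oppE -l // /mobius -sumrN.
by apply: eq_bigr => T _; rewrite mulrN.
Qed.

Lemma lead_sum k (I : Type) (r : seq I) (P : pred I) (h : I -> {set E} -> int)
    (F : I -> sqalg E) :
  (forall i, P i -> lead k (h i) (F i)) ->
  lead k (fun T => \sum_(i <- r | P i) h i T) (\sum_(i <- r | P i) F i).
Proof.
move=> hF; elim: r => [|i r IH] S kS.
  rewrite big_nil sq_0E /mobius big1 // => T _; by rewrite big_nil mulr0.
rewrite big_cons; case: ifP => Pi; last first.
  by rewrite -IH //; apply: eq_bigr => T _; rewrite big_cons Pi.
rewrite -(leadD (hF i Pi) IH) //.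
by apply: eq_bigr => T _; rewrite big_cons Pi.
Qed.

Definition homogT k f := forall S, #|S| != k -> f S = 0.

(** The function [b * h] still has degree at most k, so additive constants in the linear factors do
    not affect the leading form. *)
Lemma lead_const k b h f : homogT k f -> lead k h f ->
  lead k.+1 (fun T => b * h T) 0.
Proof.
move=> hf l S kS; rewrite sq_0E.
have <- : b * mobius h S = 0 by rewrite l ?(ltnW kS) // hf ?mulr0 // gtn_eqF.
by rewrite /mobius mulr_sumr; apply: eq_bigr => T _; rewrite mulrCA.
Qed.

(** At 0/1 points x_e is idempotent, so multiplication by it sends the monomials of S and of S
    without e both to that of S. *)
Lemma mobius_var e h S :
  mobius (fun T => (e \in T)%:R * h T) S
  = if e \in S then mobius h S + mobius h (S :\ e) else 0.
Proof.
rewrite /mobius; case: ifP => eS; last first.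
  rewrite big1 // => T TS; case: (boolP (e \in T)); last by rewrite mul0r mulr0.
  by move/(subsetP TS); rewrite eS.
rewrite (bigID (fun T : {set E} => e \in T)) /=.
rewrite [X in _ + X]big1 ?addr0; last by move=> T /andP[_ /negbTE ->]; rewrite mul0r mulr0.
rewrite [X in X + _](bigID (fun T : {set E} => e \in T)) /= -addrA.
rewrite [X in _ = _ + X](_ : _ = 0) ?addr0.
  by apply: eq_bigr => T /andP[_ ->]; rewrite mul1r.
rewrite [X in _ + X](eq_bigl (fun T : {set E} => (T \subset S) && (e \notin T))); last first.
  by move=> T; rewrite subsetD1.
rewrite -big_split big1 // => T /andP[TS eT] /=.
rewrite -mulrDl (_ : S :\: T = e |: (S :\ e :\: T)); last first.
  by apply/setP => x; rewrite !inE; case: eqP => [->|] //=; rewrite eT eS.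
by rewrite cardsU1 !inE eqxx /= andbF add1n exprS mulN1r addNr mul0r.
Qed.

(** The rules x_e^2 = x_e and x_e^2 = 0 differ only in the term [mobius h S], which vanishes when S
    has more than k elements. *)
Lemma lead_var k e h f : homogT k f -> lead k h f ->
  lead k.+1 (fun T => (e \in T)%:R * h T) (sq_var e * f).
Proof.
move=> hf l S kS; rewrite mobius_var sq_var_mulE; case: ifP => // eS.
rewrite l ?(ltnW kS) // hf ?add0r ?gtn_eqF // l //.
by move: kS; rewrite (cardsD1 e S) eS.
Qed.

Lemma homogT_var k e f : homogT k f -> homogT k.+1 (sq_var e * f).
Proof.
move=> hf S kS; rewrite sq_var_mulE; case: ifP => // eS; apply: hf.
by move: kS; rewrite (cardsD1 e S) eS add1n eqSS.
Qed.

Definition sq_lin (A B : pred E) : sqalg E :=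
  \sum_(e | A e) sq_var e - \sum_(e | B e) sq_var e.

Definition cube_lin (A B : pred E) (T : {set E}) : int :=
  \sum_(e | A e) (e \in T)%:R - \sum_(e | B e) (e \in T)%:R.

Lemma homogT_lin k A B f : homogT k f -> homogT k.+1 (sq_lin A B * f).
Proof.
move=> hf S kS; rewrite /sq_lin mulrBl !mulr_suml sq_addE sq_oppE !sq_sumE.
by rewrite !big1 ?subr0 // => e _; rewrite (homogT_var e hf).
Qed.

Lemma lead_lin k A B b h f : homogT k f -> lead k h f ->
  lead k.+1 (fun T => (cube_lin A B T + b) * h T) (sq_lin A B * f).
Proof.
move=> hf l S kS.
have hsum (C : pred E) := lead_sum (index_enum E) (P := C)
  (fun e _ => lead_var e hf l).
have := leadD (leadD (hsum A) (leadN (hsum B))) (lead_const b hf l).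
rewrite addr0 -!mulr_suml -mulrBl -/(sq_lin A B) => /(_ S kS) <-.
apply: eq_bigr => T _; rewrite mulrDl /cube_lin mulrBl !mulr_suml; congr (_ * (_ + _)).
Qed.

(** The product in the square-free algebra is the leading form of the product of functions on the
    cube; if the latter vanished at every T, all its coefficients would be zero. *)
Lemma cube_nullstellensatz (I : Type) (r : seq I) (A B : I -> pred E) (b : I -> int) :
  \prod_(i <- r) sq_lin (A i) (B i) != 0 ->
  exists T : {set E}, \prod_(i <- r) (cube_lin (A i) (B i) T + b i) != 0.
Proof.
have [lr hr] : lead (size r) (fun T => \prod_(i <- r) (cube_lin (A i) (B i) T + b i))
    (\prod_(i <- r) sq_lin (A i) (B i))
  /\ homogT (size r) (\prod_(i <- r) sq_lin (A i) (B i)).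
  elim: r => [|i r [IHl IHh]] /=; last first.
    rewrite big_cons; split; last exact: homogT_lin.
    move=> S kS; rewrite -(lead_lin _ _ (b i) IHh IHl) //.
    by apply: eq_bigr => T _; rewrite big_cons.
  rewrite big_nil; split=> S; last by rewrite cards_eq0 sq_1E => /negbTE ->.
  move=> _; rewrite sq_1E; case: eqP => [->|/eqP/set0Pn[e eS]].
    rewrite /mobius (big_pred1 set0) ?setD0 ?cards0 ?big_nil ?mulr1 // => T.
    by rewrite subset0.
  rewrite /mobius (bigID (fun T : {set E} => e \in T)) /= addrC.
  rewrite [X in _ + X](reindex_onto (fun T => e |: T) (fun T => T :\ e)) /=; last first.
    by move=> T /andP[_ eT]; rewrite setD1K.
  rewrite [X in _ + X](eq_bigl (fun T : {set E} => (T \subset S) && (e \notin T))); last first.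
    move=> T; rewrite subUset sub1set eS setU11 andbT /=; congr (_ && _).
    apply/eqP/idP => [<-|eT]; first by rewrite !inE eqxx.
    by rewrite setU1K.
  rewrite -big_split big1 // => T /andP[TS eT] /=; rewrite !big_nil !mulr1.
  rewrite (_ : S :\: T = e |: (S :\: (e |: T))); last first.
    by apply/setP => x; rewrite !inE; case: eqP => [->|] //=; rewrite eT eS.
  by rewrite cardsU1 !inE eqxx /= add1n exprS mulN1r addNr.
move=> nz; apply/existsP; apply: contraR nz.
rewrite negb_exists => /forallP h0; apply/eqP/ffunP => S; rewrite sq_0E.
case: (boolP (size r <= #|S|)%N) => kS; last by rewrite hr // neq_ltn ltnNge kS.
rewrite -lr // /mobius big1 // => T _.
by have := h0 T; rewrite negbK => /eqP ->; rewrite mulr0.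
Qed.

End SquareFreeAlgebra.

(** * Orientations from concessions along a vertex order *)

Section Elimination.
Variables (V : finType) (G : rel V) (rk : V -> nat) (con : rel V).
Hypothesis rk_inj : injective rk.
Hypothesis con_back : forall v u, con v u -> G v u && (rk u < rk v)%N.

(** The variable of an edge is indexed by the pair (later endpoint, earlier endpoint). The cutoff
    [i] keeps the vertices of rank below i, those left once the later ones are eliminated. *)
Definition out_later i w (e : V * V) : bool :=
  [&& e.2 == w, G e.1 w, (rk w < rk e.1)%N & (rk e.1 < i)%N].
Definition out_earlier w (e : V * V) : bool :=
  [&& e.1 == w, G w e.2 & (rk e.2 < rk w)%N].
Definition out_lin i w : sqalg (V * V)%type :=
  sq_lin (out_later i w) (out_earlier w).
Definition back w := [pred u | G w u && (rk u < rk w)%N].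
Definition granted i w := #|[pred u | con u w && (rk u < i)%N]|.

Lemma out_earlier_perm v :
  perm_eq (enum (out_earlier v)) [seq (v, u) | u <- enum (back v)].
Proof.
apply: uniq_perm; first exact: enum_uniq.
  by rewrite map_inj_uniq ?enum_uniq // => x y [].
move=> [x y]; rewrite mem_enum /= unfold_in /=.
apply/idP/mapP => [/and3P[/eqP -> Gy ry]|[u]]; first by exists y; rewrite // mem_enum inE Gy.
by rewrite mem_enum inE => /andP[Gu ru] [-> ->]; rewrite eqxx Gu.
Qed.

Lemma out_lin_last i v : rk v = i ->
  out_lin i.+1 v = - \sum_(e <- [seq (v, u) | u <- enum (back v)]) sq_var e.
Proof.
move=> rv; rewrite /out_lin /sq_lin big_pred0; last first.
  by move=> e; rewrite /out_later rv ltnS; case: ltngtP => //; rewrite !andbF.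
by rewrite sub0r -(perm_big _ (out_earlier_perm v)) big_enum.
Qed.

Lemma out_linS i v w : rk v = i -> (rk w < i)%N ->
  out_lin i.+1 w = out_lin i w + (if G v w then sq_var (v, w) else 0).
Proof.
move=> rv rw; rewrite /out_lin /sq_lin addrAC; congr (_ - _).
rewrite (bigID (fun e => rk e.1 < i)%N) /=; congr (_ + _).
  apply: eq_bigl => e; rewrite /out_later -!andbA; do 3![congr (_ && _)].
  by rewrite ltnS; case: (ltngtP (rk e.1) i) => //= _; rewrite ?andbF.
rewrite (eq_bigl (fun e => (e == (v, w)) && G v w)); last first.
  move=> [x y]; rewrite /out_later /= -leqNgt ltnS -!andbA -eqn_leq -rv (inj_eq rk_inj) /=.
  case: (eqVneq x v) => [->|_] /=; last by rewrite !andbF.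
  by case: (y == w) => //=; rewrite rv rw !andbT.
case: ifP => Gvw; last by rewrite big_pred0 // => e; rewrite andbF.
by rewrite (big_pred1 (v, w)) // => e; rewrite andbT.
Qed.

Lemma out_lin_free i v u w : rk v = i -> (rk w < i)%N ->
  var_free (v, u) (out_lin i w).
Proof.
move=> rv rw; apply: var_freeD; last apply: var_freeN.
  apply: var_free_sum => e /and4P[_ _ _ re]; apply: var_free_var.
  by apply: contraTneq re => <-; rewrite /= rv ltnn.
apply: var_free_sum => e /and3P[/eqP e1 _ _]; apply: var_free_var.
by apply: contraTneq rw => E; rewrite -e1 -E /= rv ltnn.
Qed.

Lemma grantedS i v w : rk v = i -> granted i.+1 w = (granted i w + con v w)%N.
Proof.
move=> rv; rewrite /granted; case Cvw: (con v w).
  rewrite (cardD1 v) inE /= Cvw rv ltnSn addnC; congr (_ + _)%N.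
  apply: eq_card => u; rewrite !inE ltnS -rv -(inj_eq rk_inj).
  by case: (ltngtP (rk u) (rk v)) => //=; rewrite ?andbF.
rewrite addn0; apply: eq_card => u; rewrite !inE ltnS -rv.
case: (ltngtP (rk u) (rk v)) => //=; rewrite ?andbF ?andbT //.
by move/rk_inj ->; rewrite Cvw.
Qed.

(** Induction eliminating the last vertex v. An earlier vertex to which v concedes loses one from
    its exponent (if positive) and one from its granted concessions, so its condition is
    preserved. *)
Lemma prod_out_lin_neq0 i (f : V -> nat) :
  (forall w, (rk w < i)%N ->
     (f w <= granted i w)%N \/ (f w + 2 * #|con w| <= granted i w + #|back w|)%N) ->
  \prod_(w | (rk w < i)%N) out_lin i w ^+ f w != 0.
Proof.
elim: i f => [|i IH] f hf; first by rewrite big_pred0 ?oner_neq0.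
case: (pickP (fun v => rk v == i)) => [v /eqP rv|nov]; last first.
  have lt_eq w : (rk w < i.+1)%N = (rk w < i)%N.
    by rewrite ltnS leq_eqVlt nov.
  have g_eq w : granted i.+1 w = granted i w.
    by apply: eq_card => u; rewrite !inE lt_eq.
  under eq_bigl => w do rewrite lt_eq.
  under eq_bigr => w _.
    rewrite /out_lin /sq_lin (eq_bigl (out_later i w)); last first.
      by move=> e; rewrite /out_later lt_eq.
    over.
  by apply: IH => w; rewrite -lt_eq -g_eq; apply: hf.
set N := [seq (v, u) | u <- enum (back v)].
have uN : uniq N by rewrite map_inj_uniq ?enum_uniq // => x y [].
have memN e : e \in N -> [/\ e.1 = v, G v e.2 & (rk e.2 < i)%N].
  by case/mapP => u; rewrite mem_enum inE rv => /andP[Gu ru] ->.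
(* With x^2 = 0, (a + x)^f = a^f + x f a^(f-1); [P] and [Q] are the two coefficients. *)
pose P (e : V * V) := out_lin i e.2 ^+ f e.2.
pose Q (e : V * V) := out_lin i e.2 ^+ (f e.2).-1 *+ f e.2.
(* A concession to a vertex of exponent 0 is dropped, since [Q] vanishes there. *)
pose J (e : V * V) := con v e.2 && (0 < f e.2)%N.
pose r := \prod_(w | (rk w < i)%N && ~~ G v w) out_lin i w ^+ f w.
have free e w : e \in N -> (rk w < i)%N -> var_free e (out_lin i w).
  by case: e => a u /memN /= [-> _ _]; apply: out_lin_free.
have back_split (F : V -> sqalg (V * V)%type) :
    \prod_(w | (rk w < i)%N) F w
    = \prod_(w | (rk w < i)%N && ~~ G v w) F w * \prod_(e <- N) F e.2.
  rewrite (bigID (G v)) /= mulrC; congr (_ * _); rewrite big_map big_enum /=.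
  by apply: eq_bigl => u; rewrite inE rv andbC.
have -> : \prod_(w | (rk w < i.+1)%N) out_lin i.+1 w ^+ f w
  = (-1) ^+ f v * ((\sum_(e <- N) sq_var e) ^+ f v
      * (r * \prod_(e <- N) (P e + sq_var e * Q e))).
  rewrite (bigD1 v) ?rv //= out_lin_last // [X in X * _ = _]exprNn -mulrA; congr (_ * (_ * _)).
  rewrite (eq_bigl (fun w => rk w < i)%N); last first.
    move=> w; rewrite ltnS -(inj_eq rk_inj) rv.
    by case: ltngtP.
  rewrite back_split; congr (_ * _).
    by apply: eq_bigr => w /andP[rw /negbTE nG]; rewrite (out_linS rv rw) nG addr0.
  rewrite !big_seq; apply: eq_bigr => e /memN [e1 Ge re].
  rewrite (out_linS rv re) Ge /P /Q; case: e e1 Ge re => a u /= -> _ _.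
  by case: (f u) => [|n]; rewrite ?mulr0n ?mulr0 ?addr0 // sq_exp_addv mulrnAr.
have hfv := hf v; rewrite rv ltnSn in hfv.
(* Nothing is conceded to the last vertex, so its condition becomes the one required by
   [elim_vars]. *)
have gv : granted i.+1 v = 0%N.
  apply: eq_card0 => u; rewrite !inE; apply/negbTE/andP => -[/con_back/andP[_ vu]].
  by rewrite ltnS -rv leqNgt vu.
have cardJ : (count J N <= #|con v|)%N.
  rewrite count_map cardE -size_filter.
  apply: uniq_leq_size; first exact: filter_uniq (enum_uniq _).
  by move=> u; rewrite mem_filter mem_enum => /andP[/andP[/= cu _] _].
have sizeN : size N = #|back v| by rewrite size_map -cardE.
apply: contra_neq (elim_vars (r := r) (P := P) (Q := Q) (J := J) (m := f v) uN _ _ _ _).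
- by move=> h0; rewrite -[LHS](signrMK (f v)) h0 mulr0.
- move=> e eN; apply: var_free_prod => w /andP[rw _].
  by apply: var_freeX; apply: free.
- move=> e e' eN /memN [_ _ re'].
  by split; [|apply: var_freeMn]; apply: var_freeX; apply: free.
- have := hfv isT; rewrite gv sizeN add0n; case=> h; [left|right].
    by apply/eqP; rewrite -leqn0.
  by apply: leq_trans h; rewrite addnC leq_add2l leq_mul2l.
pose f' w := (f w - con v w)%N.
have -> : r * \prod_(e <- N) (if J e then Q e else P e)
    = (\prod_(w | (rk w < i)%N) out_lin i w ^+ f' w)
      *+ \prod_(e <- N) (if J e then f e.2 else 1%N).
  rewrite back_split -mulrnAr -prodrMn; congr (_ * _).
    apply: eq_bigr => w /andP[_ nG]; rewrite /f'.
    by case: (boolP (con v w)) => [/con_back/andP[]|]; rewrite ?(negbTE nG) ?subn0.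
  apply: eq_bigr => e _; rewrite /J /P /Q /f'; case: (con v e.2) => /=.
    by case: (f e.2) => [|n] //=; rewrite ?subn1.
  by rewrite subn0.
(* The numerical factors coming from [Q] are positive on [J], and the algebra is torsion-free, so
   they can be discarded. *)
have -> : \prod_(e <- N) (if J e then f e.2 else 1%N)
    = (\prod_(e <- N) (if J e then f e.2 else 1%N)).-1.+1.
  rewrite prednK // prodn_gt0 // => e; rewrite /J.
  by case: ifP => // /andP[].
rewrite sq_mulrn_eq0; apply: IH => w rw.
have := hf w (ltnW rw); rewrite (grantedS _ rv) /f'.
by case: (con v w) => /=; lia.
Qed.

(* An edge (v, u) with u before v belongs to T when it is directed from u to
   v, so that the S-out-degree of the earlier endpoint grows with T. *)
Definition orient_by (T : {set V * V}) : rel V := fun x y =>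
  G x y && (if (rk x < rk y)%N then (y, x) \in T else (x, y) \notin T).

Hypothesis G_sym : symmetric G.
Hypothesis G_irr : irreflexive G.

Lemma orient_by_orientation T : orientation G (orient_by T).
Proof.
split=> u v; rewrite /orient_by (G_sym v u); case Guv: (G u v) => //=;
  (case: (ltngtP (rk u) (rk v)) => [ruv|ruv|/rk_inj uv]; last by rewrite uv G_irr in Guv);
  by case: (_ \in T).
Qed.

Lemma sum_mem_card (A : pred (V * V)) (T : {set V * V}) (f : V -> V * V) (P : pred V) :
  injective f -> (forall e, A e && (e \in T) = (e \in image f P)) ->
  \sum_(e | A e) ((e \in T)%:R : int) = #|P|%:Z.
Proof.
move=> inj_f AP; rewrite -(card_image inj_f) -sum1_card -natz natr_sum.
rewrite [RHS](eq_bigl (fun e => A e && (e \in T))) => [|e]; last by rewrite AP.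
by rewrite big_mkcondr; apply: eq_bigr => e _; case: (e \in T).
Qed.

(** Edges to later vertices leave w exactly when they are in T, and edges to earlier vertices
    exactly when they are not; the latter number [#|back w|] minus those in T. *)
Lemma outdeg_orient_by T w i : (forall v, (rk v < i)%N) ->
  (outdeg (orient_by T) w)%:Z
  = cube_lin (out_later i w) (out_earlier w) T + #|back w|%:Z.
Proof.
move=> hi; rewrite /outdeg /cube_lin.
have -> : #|orient_by T w| = (#|[pred u | [&& G w u, (rk w < rk u)%N & (u, w) \in T]]|
    + #|[pred u | [&& G w u, (rk u < rk w)%N & (w, u) \notin T]]|)%N.
  rewrite -(cardID [pred u | (rk w < rk u)%N] (orient_by T w)); congr (_ + _)%N;
    apply: eq_card => u; rewrite !inE /= unfold_in /orient_by.
    by case: (ltnP (rk w) (rk u)) => _; rewrite ?andbF ?andbT.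
  case: (ltngtP (rk w) (rk u)) => [_|_|/rk_inj ->] //=; first by rewrite andbF.
  by rewrite G_irr.
have later : \sum_(e | out_later i w e) ((e \in T)%:R : int)
    = #|[pred u | [&& G w u, (rk w < rk u)%N & (u, w) \in T]]|%:Z.
  apply: (@sum_mem_card _ _ (fun u => (u, w))) => [x y []//|[x y]].
  apply/idP/imageP => [/andP[/and4P[/= /eqP -> Gx rx _] xT]|[u]].
    by exists x; rewrite // inE (G_sym w) Gx rx xT.
  by rewrite inE => /and3P[Gu ru uT] [-> ->]; rewrite /out_later /= eqxx (G_sym u) Gu ru hi uT.
have earlier : \sum_(e | out_earlier w e) ((e \in T)%:R : int)
    = #|[pred u | [&& G w u, (rk u < rk w)%N & (w, u) \in T]]|%:Z.
  apply: (@sum_mem_card _ _ (fun u => (w, u))) => [x y []//|[x y]].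
  apply/idP/imageP => [/andP[/and3P[/= /eqP -> Gy ry] yT]|[u]].
    by exists y; rewrite // inE Gy ry yT.
  by rewrite inE => /and3P[Gu ru uT] [-> ->]; rewrite /out_earlier /= eqxx Gu ru uT.
rewrite later earlier.
have -> : #|back w| = (#|[pred u | [&& G w u, (rk u < rk w)%N & (w, u) \in T]]|
    + #|[pred u | [&& G w u, (rk u < rk w)%N & (w, u) \notin T]]|)%N.
  rewrite -(cardID [pred u | (w, u) \in T] (back w)); congr (_ + _)%N;
    by apply: eq_card => u; rewrite !inE /=; case: (G w u);
      case: (rk u < rk w)%N; rewrite /= ?andbF ?andbT.
lia.
Qed.

(** The Nullstellensatz is applied to the product of outdeg(w) - a over all w and all a in F(w): a
    point where it is nonzero is an avoiding orientation. *)
Theorem avoiding_of_concessions (F : V -> seq nat) :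
  (forall w, let c := #|[pred u | con u w]| in
     (size (F w) <= c)%N \/ (size (F w) + 2 * #|con w| <= c + #|back w|)%N) ->
  exists D : rel V, orientation G D /\ forall w, outdeg D w \notin F w.
Proof.
move=> hF; pose i := (\max_w rk w).+1.
have hi v : (rk v < i)%N by rewrite ltnS leq_bigmax.
have nz : \prod_(w | (rk w < i)%N) out_lin i w ^+ size (F w) != 0.
  apply: prod_out_lin_neq0 => w _.
  have -> : granted i w = #|[pred u | con u w]|; last exact: hF.
  by apply: eq_card => u; rewrite !inE hi andbT.
pose r := [seq (w, a) | w <- enum V, a <- F w].
have /cube_nullstellensatz : \prod_(p <- r) out_lin i p.1 != 0.
  rewrite big_allpairs_dep /= big_enum /=; apply: contra_neq nz => h0.
  rewrite -h0; apply: eq_big => [w|w _]; first by rewrite hi.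
  by rewrite big_const_seq count_predT -Monoid.iteropE.
case/(_ (fun p => #|back p.1|%:Z - p.2%:Z)) => T hT.
exists (orient_by T); split; first exact: orient_by_orientation.
move=> w; apply/negP => wF; move: hT; rewrite prodf_seq_neq0 => /allP.
move/(_ (w, outdeg (orient_by T) w)); rewrite /= addrA -outdeg_orient_by // subrr eqxx.
have rw : (w, outdeg (orient_by T) w) \in r.
  by apply/allpairsPdep; exists w, (outdeg (orient_by T) w); rewrite mem_enum.
by move=> /(_ rw).
Qed.

End Elimination.

(** * The local lemma *)

Section LocalLemma.
Variables (V X I : finType).
Implicit Types (U : {set V}) (A B : {set {ffun V -> X}}).

Definition determined U A := forall w w' : {ffun V -> X},
  (forall u, u \in U -> w u = w' u) -> (w \in A) = (w' \in A).

(* Swapping the coordinates in U of two independent samples maps A * B onto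
   (A :&: B) * setT. *)
Lemma determined_indep U A B : determined U A -> determined (~: U) B ->
  (#|A| * #|B| = #|A :&: B| * #|{ffun V -> X}|)%N.
Proof.
move=> dA dB.
pose mix (w1 w2 : {ffun V -> X}) : {ffun V -> X} :=
  [ffun u => if u \in U then w1 u else w2 u].
pose sw (p : {ffun V -> X} * {ffun V -> X}) := (mix p.1 p.2, mix p.2 p.1).
have mixK w1 w2 : mix (mix w1 w2) (mix w2 w1) = w1.
  by apply/ffunP => u; rewrite !ffunE; case: (u \in U).
have swK : involutive sw by move=> [a b]; rewrite /sw !mixK.
rewrite -cardsX -[X in (_ * X)%N]cardsT -cardsX -(card_preimset _ (inv_inj swK)).
apply: eq_card => -[w1 w2]; rewrite !inE /= andbT; congr (_ && _).
  by apply: dA => u uU; rewrite ffunE uU.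
by apply: dB => u; rewrite inE ffunE => /negbTE ->.
Qed.

(** The symmetric local lemma for the uniform measure, stated by counting. Induction on the size of
    S shows that, given that all events of S fail, each event has conditional probability at most
    2p. *)
Lemma local_lemma (R : realFieldType) (A : I -> {set {ffun V -> X}})
    (U : I -> {set V}) (p : R) (D : nat) :
  (0 < #|X|)%N -> (0 < D)%N -> 0 <= p -> 4 * p * D%:R <= 1 ->
  (forall i, determined (U i) (A i)) ->
  (forall i, #|A i|%:R <= p * #|{ffun V -> X}|%:R) ->
  (forall i, (#|[set k | ~~ [disjoint U i & U k]]| <= D)%N) ->
  exists w, forall i, w \notin A i.
Proof.
move=> X0 D0 p0 pD dA hA hD.
have D1 : 1 <= D%:R :> R by rewrite ler1n.
have O0 : 0 < #|{ffun V -> X}|%:R :> R by rewrite ltr0n card_ffun expn_gt0 X0.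
pose good (S : {set I}) : {set {ffun V -> X}} := [set w | [forall i in S, w \notin A i]].
have goodP (S : {set I}) (w : {ffun V -> X}) :
    reflect (forall i, i \in S -> w \notin A i) (w \in good S).
  by rewrite inE; apply: forall_inP.
have step n : forall (S : {set I}) i, (#|S| <= n)%N -> #|A i :&: good S|%:R <= 2 * p * #|good S|%:R.
  elim: n => [|n IH] S i Sn.
    have S0 : S = set0 by apply/eqP; rewrite -cards_eq0 -leqn0.
    have -> : good S = setT.
      by apply/setP => w; rewrite [RHS]inE; apply/goodP => k; rewrite S0 inE.
    rewrite setIT cardsT; apply: le_trans (hA i) _.
    by rewrite ler_wpM2r ?ler0n //; lra.
  pose Gam := [set k | ~~ [disjoint U i & U k]].
  pose S2 := S :\: Gam.
  have dS2 : determined (~: U i) (good S2).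
    move=> w w' ww'; apply/goodP/goodP => h k kS; have := h k kS;
      rewrite (@dA k w w') // => u uk; apply: ww'; rewrite inE;
      move: kS; rewrite !inE negbK => /andP[dis _];
      by rewrite (disjointFl dis uk).
  have main : #|A i :&: good S2|%:R <= p * #|good S2|%:R.
    rewrite -(ler_pM2r O0) -natrM -(determined_indep (dA i) dS2) natrM.
    by rewrite mulrAC ler_wpM2r ?ler0n.
  have sub : good S \subset good S2.
    by apply/subsetP => w /goodP h; apply/goodP => k; rewrite inE => /andP[_ /h].
  (* Given [good S2], the events meeting [U i] have total probability at most 2pD <= 1/2, so
     restoring them at most halves the count. *)
  have half : #|good S2|%:R <= 2 * #|good S|%:R :> R.
    case: (eqVneq S2 S) => [->|S2S].
      by have := ler0n R #|good S|; lra.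
    have S2n : (#|S2| <= n)%N.
      rewrite -ltnS; apply: leq_trans Sn; apply: proper_card.
      by rewrite properEneq S2S subsetDl.
    have cover : good S2 \subset good S :|: \bigcup_(k in Gam) (A k :&: good S2).
      apply/subsetP => w wS2; rewrite inE; apply/orP.
      case: (boolP (w \in good S)) => wS; [by left|right].
      move: wS; rewrite inE negb_forall => /existsP[k]; rewrite negb_imply negbK.
      move=> /andP[kS wk]; apply/bigcupP; exists k; last by rewrite inE wk.
      apply: contraT => kG; move/goodP: wS2 => /(_ k).
      by rewrite inE kG kS wk => /(_ isT).
    have c1 : (#|good S2| <= #|good S| + \sum_(k in Gam) #|A k :&: good S2|)%N.
      apply: leq_trans (subset_leq_card cover) _.
      apply: leq_trans (leq_card_setU _ _) _; rewrite leq_add2l.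
      elim/big_rec2: _ => [|k m B _ IHB]; first by rewrite cards0.
      by apply: leq_trans (leq_card_setU _ _) _; rewrite leq_add2l.
    have c2 : (\sum_(k in Gam) #|A k :&: good S2|)%:R
        <= D%:R * (2 * p * #|good S2|%:R) :> R.
      rewrite natr_sum; apply: le_trans (_ : \sum_(k in Gam) (2 * p * #|good S2|%:R) <= _).
        by apply: ler_sum => k _; apply: IH.
      rewrite sumr_const -[X in X <= _]mulr_natl; apply: ler_wpM2r; last by rewrite ler_nat hD.
      by rewrite !mulr_ge0 ?ler0n.
    have c3 : #|good S2|%:R <= #|good S|%:R + D%:R * (2 * p * #|good S2|%:R) :> R.
      apply: le_trans (_ : (#|good S| + \sum_(k in Gam) #|A k :&: good S2|)%:R <= _).
        by rewrite ler_nat.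
      by rewrite natrD lerD2l.
    have c4 : 4 * p * D%:R * #|good S2|%:R <= 1 * #|good S2|%:R :> R.
      by rewrite ler_wpM2r ?ler0n.
    by nra.
  apply: le_trans (_ : #|A i :&: good S2|%:R <= _).
    by rewrite ler_nat subset_leq_card // setIS.
  apply: le_trans main _.
  by rewrite [2 * p]mulrC -mulrA ler_wpM2l.
have pos (S : {set I}) : (0 < #|good S|)%N.
  have [n] := ubnP #|S|; elim: n S => // n IH S Sn.
  case: (set_0Vmem S) => [->|[i iS]].
    apply/card_gt0P; have [x0 _] := card_gt0P X0.
    by exists [ffun=> x0]; apply/goodP => k; rewrite inE.
  have {IH} := IH (S :\ i); rewrite (cardsD1 i S) iS add1n ltnS in Sn.
  move=> /(_ Sn) pos'; have h := step _ (S :\ i) i (leqnn _).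
  have E : good S = good (S :\ i) :\: A i.
    apply/setP => w; rewrite [RHS]inE; apply/goodP/andP.
      by move=> h'; split; [exact: h'|apply/goodP => k; rewrite inE => /andP[_ /h']].
    move=> [wi /goodP h'] k kS; case: (eqVneq k i) => [->//|ki].
    by apply: h'; rewrite !inE ki.
  rewrite E lt0n; apply/eqP => h0.
  have := cardsID (A i) (good (S :\ i)); rewrite h0 addn0 setIC => h1.
  move: h; rewrite h1 -[X in X <= _]mul1r ler_pM2r ?ltr0n //.
  have : p * 1 <= p * D%:R by rewrite ler_wpM2l.
  lra.
have [w /goodP h] := card_gt0P (pos setT).
by exists w => i; apply: h; rewrite inE.
Qed.

End LocalLemma.

(** * Equidistributed vertex types *)

Section Equidistribution.
Variable R : realType.

Definition scarce (V X : finType) (eta : R) (W : {set V}) (x : X) : {set {ffun V -> X}} :=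
  [set w : {ffun V -> X} |
    #|[set u in W | w u == x]|%:R * #|X|%:R < (1 - eta) * #|W|%:R].

(* Exponential Markov inequality with parameter eta. *)
Lemma card_scarce (V X : finType) (eta : R) (W : {set V}) (x : X) : 0 < eta < 1 ->
  #|scarce eta W x|%:R
  <= expR (- (eta ^+ 3 / (1 + eta) / #|X|%:R) * #|W|%:R) * #|{ffun V -> X}|%:R.
Proof.
move=> /andP[eta0 eta1]; set N : R := #|X|%:R.
have N0 : 0 < N by rewrite ltr0n; apply/card_gt0P; exists x.
have eta10 : 0 < 1 + eta by lra.
pose F u y : R := if (u \in W) && (y == x) then expR (- eta) else 1.
(* This factor makes the weight at least 1 on [scarce], where fewer than (1 - eta)|W| / |X| vertices
   of W have type x. *)
pose K : R := expR (eta * (1 - eta) / N * #|W|%:R).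
have step1 : #|scarce eta W x|%:R <= \sum_(w : {ffun V -> X}) K * \prod_u F u (w u).
  rewrite -sum1_card natr_sum big_mkcond /=; apply: ler_sum => w _.
  have -> : \prod_u F u (w u) = expR (- eta * #|[set u in W | w u == x]|%:R).
    rewrite mulrC expRM_natl -prodr_const big_mkcond [RHS]big_mkcond /=.
    by apply: eq_bigr => u _; rewrite /F inE.
  rewrite /K -expRD; case: ifP; last by move=> _; exact: expR_ge0.
  rewrite inE -/N => h; rewrite -[leLHS]expR0 ler_expR.
  have -> : eta * (1 - eta) / N * #|W|%:R + - eta * #|[set u in W | w u == x]|%:R
    = eta / N * ((1 - eta) * #|W|%:R - #|[set u in W | w u == x]|%:R * N).
    by field; rewrite gt_eqF.
  by rewrite mulr_ge0 ?divr_ge0 ?subr_ge0 // ltW.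
apply: le_trans step1 _; rewrite -mulr_sumr -bigA_distr_bigA /=.
have e_eta : expR (- eta) <= (1 + eta)^-1.
  by rewrite expRN lef_pV2 ?posrE ?expR_gt0 // expR_ge1Dx.
(* A vertex of W contributes N - 1 + e^(-eta) <= N (1 - eta / (1 + eta) / N), and 1 - t <=
   e^(-t). *)
have step2 u : \sum_y F u y <= N * (if u \in W then expR (- (eta / (1 + eta) / N)) else 1).
  rewrite /F; case: (u \in W) => /=; last by rewrite sumr_const mulr1.
  rewrite (bigD1 x) //= eqxx (eq_bigr (fun=> 1)) => [|y /negbTE -> //].
  rewrite sumr_const cardC1.
  have -> : (1 *+ #|X|.-1 : R) = N - 1.
    rewrite /N -[in RHS](prednK (n := #|X|)); first by rewrite -addn1 natrD addrK.
    by apply/card_gt0P; exists x.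
  have : 1 - eta / (1 + eta) / N <= expR (- (eta / (1 + eta) / N)) by exact: expR_ge1Dx.
  move=> h; have : N * (1 - eta / (1 + eta) / N) <= N * expR (- (eta / (1 + eta) / N)).
    by rewrite ler_wpM2l // ltW.
  have -> : N * (1 - eta / (1 + eta) / N) = N - 1 + (1 + eta)^-1.
    by field; rewrite !gt_eqF.
  lra.
apply: le_trans (_ : K * \prod_u (N *
  (if u \in W then expR (- (eta / (1 + eta) / N)) else 1)) <= _).
  rewrite ler_wpM2l ?expR_ge0 //; apply: ler_prod => u _; rewrite step2 andbT.
  by apply: sumr_ge0 => y _; rewrite /F; case: ifP => _; rewrite ?expR_ge0.
rewrite big_split /= prodr_const -big_mkcond prodr_const /= -expRM_natl.
rewrite card_ffun natrX mulrCA [leRHS]mulrC ler_wpM2l ?exprn_ge0 ?(ltW N0) //.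
(* The exponents combine through eta / (1 + eta) - eta (1 - eta) = eta^3 / (1 + eta). *)
rewrite /K -expRD ler_expR le_eqVlt; apply/orP; left; apply/eqP.
by field; rewrite !gt_eqF.
Qed.

Lemma min_deg_le (V : finType) (G : rel V) v : (min_deg G <= deg G v)%N.
Proof.
rewrite /min_deg; elim: (index_enum V) (mem_index_enum v) => // u r IH.
rewrite inE big_cons geq_min => /orP[/eqP ->|/IH ->]; rewrite ?leqnn // orbT //.
Qed.

Lemma deg_le_max (V : finType) (G : rel V) v : (deg G v <= max_deg G)%N.
Proof. exact: leq_bigmax. Qed.

(** The local lemma with one event per pair (v, x): too few neighbours of v have type x. Each event
    has probability at most e^(-kap delta) and shares vertices with at most |X| Delta^2 events, so
    Delta <= e^(kap delta / 4) suffices for large delta. *)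
Lemma exists_equidistributed (X : finType) (eta : R) : 0 < eta < 1 -> (0 < #|X|)%N ->
  exists (c : R) (delta0 : nat), 0 < c /\
    forall (V : finType) (G : rel V), symmetric G ->
      (delta0 <= min_deg G)%N ->
      (max_deg G)%:R <= expR (c * (min_deg G)%:R) ->
      exists tau : V -> X, forall v x,
        (1 - eta) * (deg G v)%:R
        <= #|[pred u | G v u && (tau u == x)]|%:R * #|X|%:R.
Proof.
move=> eta01 X0; have /andP[eta0 eta1] := eta01.
pose kap : R := eta ^+ 3 / (1 + eta) / #|X|%:R.
have kap0 : 0 < kap.
  apply: divr_gt0; last by rewrite ltr0n.
  by apply: divr_gt0; [exact: exprn_gt0|lra].
(* Large enough for 4 (|X| + 1) <= e^(kap delta / 2), by 1 + t <= e^t. *)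
pose d0 := Num.bound (8 * (#|X|.+1)%:R / kap).
exists (kap / 4), d0; split; first by rewrite divr_gt0.
move=> V G symG d0min maxG.
pose nb v := [set u | G v u].
have nbE v : #|nb v| = deg G v by rewrite cardsE.
(* The successor keeps [D] positive, as the local lemma requires. *)
pose D := (#|X| * max_deg G ^ 2).+1.
pose p := expR (- kap * (min_deg G)%:R).
have big : 8 * (#|X|.+1)%:R <= kap * (min_deg G)%:R.
  rewrite -ler_pdivrMl // mulrC; apply: le_trans (_ : d0%:R <= _); last by rewrite ler_nat.
  apply/ltW/archi_boundP; apply: divr_ge0; last exact: ltW.
  by rewrite mulr_ge0 ?ler0n.
have [] := @local_lemma V X (V * X)%type R (fun i => scarce eta (nb i.1) i.2)
  (fun i => nb i.1) p D X0 isT (expR_ge0 _).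
- have DE : D%:R <= (#|X|.+1)%:R * expR (kap / 2 * (min_deg G)%:R) :> R.
    have -> : expR (kap / 2 * (min_deg G)%:R) = expR (kap / 4 * (min_deg G)%:R) ^+ 2 :> R.
      by rewrite expr2 -expRD; congr expR; field.
    have : (max_deg G)%:R ^+ 2 <= expR (kap / 4 * (min_deg G)%:R) ^+ 2 :> R.
      by rewrite lerXn2r ?nnegrE ?ler0n ?expR_ge0.
    have : 1 <= expR (kap / 4 * (min_deg G)%:R) ^+ 2 :> R.
      rewrite exprn_ege1 // -[leLHS]expR0 ler_expR mulr_ge0 ?ler0n //.
      by rewrite divr_ge0 // ltW.
    have -> : D%:R = #|X|%:R * (max_deg G)%:R ^+ 2 + 1 :> R.
      by rewrite /D -addn1 natrD natrM natrX.
    have -> : (#|X|.+1)%:R = #|X|%:R + 1 :> R by rewrite -addn1 natrD.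
    have := ler0n R #|X|; nra.
  have pE : p = expR (- (kap / 2) * (min_deg G)%:R) * expR (- (kap / 2) * (min_deg G)%:R).
    by rewrite /p -expRD; congr expR; field.
  set a := expR (kap / 2 * (min_deg G)%:R) in DE.
  have aE : expR (- (kap / 2) * (min_deg G)%:R) = a^-1 by rewrite mulNr expRN.
  have a0 : 0 < a by exact: expR_gt0.
  have a1 : 4 * (#|X|.+1)%:R <= a.
    apply: le_trans (expR_ge1Dx _); lra.
  rewrite pE aE; apply: le_trans (_ : 4 * (a^-1 * a^-1) * ((#|X|.+1)%:R * a) <= _).
    by rewrite ler_wpM2l // !mulr_ge0 ?invr_ge0 // ltW.
  have -> : 4 * (a^-1 * a^-1) * ((#|X|.+1)%:R * a) = 4 * (#|X|.+1)%:R / a.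
    by field; rewrite gt_eqF.
  by rewrite ler_pdivrMr // mul1r.
- move=> i w w' ww'; rewrite !inE; congr (_%:R * _ < _).
  apply: eq_card => u; rewrite !inE; case: (boolP (G i.1 u)) => //= Gu.
  by rewrite ww' // inE.
- move=> i; apply: le_trans (card_scarce _ _ eta01) _.
  rewrite ler_wpM2r ?ler0n // ler_expR -/kap !mulNr lerN2 ler_wpM2l ?(ltW kap0) //.
  by rewrite ler_nat nbE min_deg_le.
- move=> i; apply: leqW.
  pose B := (\bigcup_(u in nb i.1) nb u)%SET.
  have sub : [set k : V * X | ~~ [disjoint nb i.1 & nb k.1]] \subset setX B setT.
    apply/subsetP => k; rewrite inE => /pred0Pn[u /andP[u1 u2]].
    rewrite !inE andbT; apply/bigcupP; exists u => //.
    by move: u2; rewrite !inE symG.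
  apply: leq_trans (subset_leq_card sub) _; rewrite cardsX cardsT mulnC leq_mul2l.
  apply/orP; right.
  apply: leq_trans (_ : \sum_(u in nb i.1) max_deg G <= _)%N.
    rewrite /B; elim/big_rec2: _ => [|u m A _ h]; first by rewrite cards0.
    apply: leq_trans (leq_card_setU _ _) _.
    by rewrite leq_add // nbE deg_le_max.
  by rewrite sum_nat_const -mulnn leq_mul2r nbE deg_le_max orbT.
move=> w hw; exists w => v x; have := hw (v, x); rewrite inE -leNgt nbE => h.
apply: le_trans h _; rewrite le_eqVlt; apply/orP; left; apply/eqP.
by congr (_%:R * _); apply: eq_card => u; rewrite !inE.
Qed.

End Equidistribution.

(** * The concession pattern *)

(** The rows are consecutive intervals of length p laid around a cycle of length q. As p <= q, an
    interval does not overlap itself; as p p <= q s, they go round at most s times in all, so each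
    point is covered at most s times. *)
Lemma exists_biregular p q s : (p <= q)%N -> (p * p <= q * s)%N ->
  exists B : 'I_p -> 'I_q -> bool,
    (forall x, (p <= #|[pred w | B x w]|)%N) /\
    (forall w, (#|[pred x | B x w]| <= s)%N).
Proof.
move=> pq pqs.
exists (fun (x : 'I_p) (w : 'I_q) =>
  [exists t : 'I_p, (x * p + t) %% q == w :> nat])%N; split=> [x|w].
  have q0 : (0 < q)%N by apply: leq_trans pq; apply: leq_ltn_trans (ltn_ord x).
  pose g (t : 'I_p) := Ordinal (ltn_pmod (x * p + t) q0).
  have g_inj : injective g.
    move=> t t' /(congr1 val) /= /eqP; rewrite eqn_modDl => /eqP.
    rewrite !modn_small; first by move/val_inj.
      exact: leq_trans (ltn_ord _) pq.
    exact: leq_trans (ltn_ord _) pq.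
  rewrite -[X in (X <= _)%N]card_ord -(card_codom g_inj).
  apply: subset_leq_card; apply/subsetP => _ /codomP[t ->].
  by rewrite inE; apply/existsP; exists t.
have q0 : (0 < q)%N by apply: leq_ltn_trans (ltn_ord w).
pose A := [pred x : 'I_p | [exists t : 'I_p, (x * p + t) %% q == w :> nat]%N].
(* The turn on which interval x covers w, written without the offset t. *)
pose m (x : 'I_p) := ((x * p + (q.-1 - w)) %/ q)%N.
have mP (x : 'I_p) : x \in A -> (m x < s)%N /\ exists t : 'I_p, (x * p + t = m x * q + w)%N.
  rewrite inE => /existsP[t /eqP tw]; have eM := divn_eq (x * p + t) q.
  rewrite tw in eM; set M := ((x * p + t) %/ q)%N in eM.
  have tp := ltn_ord t; have xp := ltn_ord x; have wq := ltn_ord w.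
  have -> : m x = M.
    rewrite /m (_ : (x * p + (q.-1 - w) = M * q + (q.-1 - t))%N); last by lia.
    by rewrite divnMDl // divn_small ?addn0 //; lia.
  split; last by exists t.
  have : (x.+1 * p <= p * p)%N by rewrite leq_mul2r xp orbT.
  rewrite mulSn => hx; have : (M * q < s * q)%N by rewrite [(s * q)%N]mulnC; lia.
  by rewrite ltn_mul2r q0.
(* Distinct intervals cover w on distinct turns: position m q + w determines x on division by p. *)
rewrite -[leqRHS](size_iota 0) cardE -(size_map m); apply: uniq_leq_size.
  rewrite map_inj_in_uniq ?enum_uniq // => x y; rewrite !mem_enum => xA yA mxy.
  have [_ [t et]] := mP x xA; have [_ [u eu]] := mP y yA.
  apply: val_inj => /=; have p0 : (0 < p)%N by apply: leq_ltn_trans (ltn_ord x).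
  have : ((x * p + t) %/ p = (y * p + u) %/ p)%N by rewrite et eu mxy.
  by rewrite !divnMDl // !divn_small // !addn0.
by move=> k /mapP[x]; rewrite mem_enum => /mP[ms _] ->; rewrite mem_iota.
Qed.

Section Types.
Local Open Scope nat_scope.
Variables (K p q s : nat) (B : 'I_p -> 'I_q -> bool).
Hypothesis rowB : forall x, (p <= #|[pred w | B x w]|)%N.
Hypothesis colB : forall w, (#|[pred x | B x w]| <= s)%N.

(* Inl types are the early ones, of coarse position a.1 in [0, K); inr types come
   later, at coarse position K + a.1.  The fine coordinates and the biregular B,
   of density s / p ~ p / (2 s) ~ 1 / sqrt 2, realise the density of the
   concessions from late to early types. *)
Definition vtype : Type := ('I_K * ('I_p + 'I_q))%type.
HB.instance Definition _ := Finite.on vtype.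

Definition type_rank (a : vtype) : nat :=
  match a.2 with inl _ => a.1 | inr _ => (K + a.1)%N end.

Definition type_con (a b : vtype) : bool :=
  match a.2, b.2 with
  | inl _, inl _ => (b.1 < a.1)%N
  | inr w, inl x => (K <= a.1 + b.1)%N && B x w
  | _, inr _ => false
  end.

Lemma type_con_rank a b : type_con a b -> (type_rank b < type_rank a)%N.
Proof.
case: a b => [i [x|w]] [j [y|z]] //=; rewrite /type_con /type_rank //= => _.
by apply: leq_trans (ltn_ord j) _; apply: leq_addr.
Qed.

Lemma card_vtype_pred (P : pred vtype) : #|P| =
  \sum_(i < K) (#|[pred x | P (i, inl x)]| + #|[pred w | P (i, inr w)]|).
Proof.
rewrite -sum1_card big_mkcond /=.
rewrite (eq_bigr (fun a : vtype => (P (a.1, a.2) : nat))); last first.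
  by case=> i y _; rewrite unfold_in; case: (P _).
rewrite -(pair_bigA _ (fun i y => (P (i, y) : nat))) /=.
apply: eq_bigr => i _; rewrite big_sumType /= -!sum1_card.
by congr (_ + _)%N; rewrite [RHS]big_mkcond; apply: eq_bigr => x _ /=; rewrite inE; case: (P _).
Qed.

Lemma sum_ord_lt k : (k <= K)%N -> \sum_(i < K) (i < k)%N = k.
Proof.
move=> kK; rewrite -[RHS]card_ord -sum1_card (big_ord_widen K (fun=> 1%N) kK).
by rewrite [RHS]big_mkcond; apply: eq_bigr => i _; case: ifP.
Qed.

Lemma sum_ord_compl_lt k : (k <= K)%N -> \sum_(i < K) (K <= k + i)%N = k.
Proof.
move=> kK; rewrite -[RHS]sum_ord_lt // (reindex_inj rev_ord_inj) /=.
by apply: eq_bigr => i _; congr nat_of_bool; have := ltn_ord i; lia.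
Qed.

(** The K - 1 - i later early positions give p types each, and the i late positions j with K <= i +
    j give at least p each through a row of [B]. Types at the same early position concede nothing to
    each other, hence [K.-1]. *)
Lemma card_type_granted i x : (K.-1 * p <= #|[pred a | type_con a (i, inl x)]|)%N.
Proof.
rewrite card_vtype_pred.
apply: leq_trans (_ : \sum_(j < K) ((i < j) * p + (K <= i + j) * p) <= _)%N.
  rewrite big_split /= -!big_distrl /= sum_ord_compl_lt ?(ltnW (ltn_ord i)) //.
  have : (\sum_(j < K) (i < j) + \sum_(j < K) (j < i.+1) = K)%N.
    rewrite -big_split /= -[RHS]card_ord -sum1_card; apply: eq_bigr => j _.
    by rewrite ltnS; case: ltnP.
  rewrite sum_ord_lt // -mulnDl leq_mul2r; set S := (\sum_(j < K) _).
  by rewrite addnS => hS; apply/orP; right; rewrite -[X in X.-1 <= _]hS.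
apply: leq_sum => j _; apply: leq_add.
  by case: ltnP => ij; rewrite ?mul0n // mul1n -[X in (X <= _)%N]card_ord;
     apply: subset_leq_card; apply/subsetP => y _; rewrite inE.
case: (leqP K (i + j)) => ij; rewrite ?mul0n // mul1n; apply: leq_trans (rowB x) _.
by apply: subset_leq_card; apply/subsetP => y; rewrite !inE /type_con /= addnC ij.
Qed.

(** For q = 2 s, twice this bound equals the i q late types of smaller rank, so b - 2j is still at
    least the number K p of early types. *)
Lemma card_type_conceded i w : (#|[pred b | type_con (i, inr w) b]| <= i * s)%N.
Proof.
rewrite card_vtype_pred -[X in _ <= X * _](sum_ord_compl_lt (ltnW (ltn_ord i))) big_distrl /=.
apply: leq_sum => j _; rewrite [X in (_ + X)%N]eq_card0 ?addn0 //.
case: (leqP K (i + j)) => ij; last by rewrite eq_card0 // => y; rewrite inE /type_con /= leqNgt ij.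
rewrite mul1n; apply: leq_trans (colB w).
by apply: subset_leq_card; apply/subsetP => y; rewrite !inE /type_con /= => /andP[].
Qed.

Lemma card_type_below i w :
  #|[pred b | (type_rank b < type_rank (i, inr w))%N]| = (K * p + i * q)%N.
Proof.
rewrite card_vtype_pred big_split /=; congr (_ + _)%N.
  rewrite -[K in RHS]card_ord -sum_nat_const; apply: eq_bigr => j _.
  rewrite -[RHS]card_ord; apply: eq_card => y; rewrite !inE /type_rank /=.
  by apply: leq_trans (ltn_ord j) _; apply: leq_addr.
rewrite -[X in _ = X * _](sum_ord_lt (ltnW (ltn_ord i))) big_distrl /=; apply: eq_bigr => j _.
case: ltnP => ij; last first.
  by apply: eq_card0 => y; rewrite !inE /type_rank /= ltn_add2l ltnNge ij.
by rewrite mul1n -[RHS]card_ord; apply: eq_card => y; rewrite !inE /type_rank /= ltn_add2l.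
Qed.

Lemma card_vtype : #|{: vtype}| = (K * (p + q))%N.
Proof. by rewrite card_prod card_sum !card_ord. Qed.

End Types.

(** For s >= 1/e take p to be the integer part of s sqrt 2; then p / (p + 2 s) is close to sqrt 2 /
    (sqrt 2 + 2) = sqrt 2 - 1. The two inequalities are those of [exists_biregular] with q = 2 s. *)
Lemma exists_sqrt2_ratio (R : realType) (e : R) : 0 < e ->
  exists p s : nat, [/\ (0 < p)%N, (p <= 2 * s)%N, (p * p <= 2 * s * s)%N
    & Num.sqrt 2 - 1 - e <= p%:R / (p + 2 * s)%N%:R].
Proof.
move=> e0; pose s := (Num.bound (e^-1)).+1.
have se : 1 <= s%:R * e.
  rewrite -ler_pdivrMr // mul1r; apply: le_trans (ltW (archi_boundP _)) _.
    by rewrite invr_ge0 ltW.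
  by rewrite ler_nat.
have ex_p : exists p, (p * p <= 2 * s * s)%N by exists 0%N.
have ub_p p : (p * p <= 2 * s * s)%N -> (p <= 2 * s)%N by nia.
case: (ex_maxnP ex_p ub_p) => p hp pmax; exists p, s.
have p0 : (0 < p)%N by apply: pmax; rewrite /s; lia.
split; rewrite ?ub_p //.
have : (2 * s * s < p.+1 * p.+1)%N.
  by rewrite ltnNge; apply/negP => /pmax; rewrite ltnn.
set r : R := Num.sqrt 2.
have r0 : 0 <= r by exact: sqrtr_ge0.
have rr : r ^+ 2 = 2 by rewrite sqr_sqrtr.
have r1 : 1 < r by nra.
have r2 : r < 2 by nra.
rewrite -(ltr_nat R) !natrM -[in p.+1%:R]addn1 natrD => hlt.
have s0 : 0 <= s%:R :> R by [].
have p0' : 0 < p%:R :> R by rewrite ltr0n.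
have rs : r * s%:R < p%:R + 1 by nra.
rewrite ler_pdivlMr; last by rewrite natrD; nra.
rewrite natrD natrM.
nra.
Qed.

Section Design.
Variables (R : realType) (K p s : nat) (eta beta : R).
Variable B : 'I_p -> 'I_(2 * s) -> bool.
Hypothesis rowB : forall x, (p <= #|[pred w | B x w]|)%N.
Hypothesis colB : forall w, (#|[pred x | B x w]| <= s)%N.
Local Notation T := (vtype K p (2 * s)).
Local Notation N := #|{: T}|.

(** The concessions between types are pulled back along [tau]. Vertices of early type satisfy the
    first alternative of [avoiding_of_concessions], those of late type the second. *)
Lemma avoiding_of_equidistributed (V : finType) (G : rel V) (F : V -> seq nat)
    (tau : V -> T) :
  simple_graph G -> 0 < eta < 1 -> (0 < N)%N ->
  beta * N%:R <= (1 - eta) * (K.-1 * p)%N%:R ->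
  beta * N%:R + 3 * eta * N%:R <= (K * p)%N%:R ->
  (forall v x, (1 - eta) * (deg G v)%:R
     <= #|[pred u | G v u && (tau u == x)]|%:R * N%:R) ->
  (forall v, (size (F v))%:R <= beta * (deg G v)%:R) ->
  exists D : rel V, orientation G D /\ forall w, outdeg D w \notin F w.
Proof.
move=> [symG irrG] /andP[eta0 eta1] N0 hT hL equi hF.
have low v (P : pred T) : (1 - eta) * (deg G v)%:R * #|P|%:R
    <= #|[pred u | G v u && P (tau u)]|%:R * N%:R :> R.
  have -> : #|[pred u | G v u && P (tau u)]|
      = (\sum_(x | P x) #|[pred u | G v u && (tau u == x)]|)%N.
    rewrite -sum1_card (partition_big tau P) /=; last by move=> u /andP[].
    apply: eq_bigr => x Px; rewrite -sum1_card; apply: eq_bigl => u.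
    by rewrite !inE -andbA; case: eqP => [->|]; rewrite ?andbF ?Px.
  rewrite natr_sum mulr_suml -sum1_card natr_sum mulr_sumr.
  by apply: ler_sum => x _; rewrite mulr1.
(* An upper bound for a set of types is the lower bound for its complement. *)
have up v (P : pred T) : #|[pred u | G v u && P (tau u)]|%:R * N%:R
    <= (deg G v)%:R * (#|P|%:R + eta * N%:R) :> R.
  have := low v (predC P).
  have -> : (deg G v)%:R = #|[pred u | G v u && P (tau u)]|%:R
      + #|[pred u | G v u && predC P (tau u)]|%:R :> R.
    rewrite -natrD /deg -(cardID [pred u | P (tau u)] (G v)); congr (_ + _)%N%:R;
      by apply: eq_card => u; rewrite !inE /= ?[_ && P _]andbC // andbC.
  rewrite -(cardC P) natrD.
  set a := #|[pred u | G v u && P (tau u)]|%:R; set b := #|[pred u | G v u && predC P (tau u)]|%:R.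
  change #|[predC P]| with #|predC P|.
  have : 0 <= (a + b) * (eta * #|P|%:R) by rewrite !mulr_ge0 ?addr_ge0 ?ler0n ?(ltW eta0).
  lra.
(* Vertices are ordered by type rank, with ties broken by the enumeration of V. *)
pose rk v := (type_rank (tau v) * #|V| + enum_rank v)%N.
have rk_lt u v : (type_rank (tau u) < type_rank (tau v))%N -> (rk u < rk v)%N.
  move=> h; rewrite /rk; apply: leq_trans (_ : (type_rank (tau u)).+1 * #|V| <= _)%N.
    by rewrite [X in (_ < X)%N]mulSn addnC ltn_add2r.
  by apply: leq_trans (leq_addr _ _); rewrite leq_mul2r h orbT.
have rk_inj : injective rk.
  move=> u v uv; apply/enum_rank_inj/val_inj => /=.
  have V0 : (0 < #|V|)%N by apply: leq_ltn_trans (ltn_ord (enum_rank u)).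
  by rewrite -(modn_small (ltn_ord (enum_rank u))) -(modnMDl (type_rank (tau u)))
    -/(rk u) uv /rk modnMDl modn_small.
pose con v u := G v u && type_con B (tau v) (tau u).
have con_back v u : con v u -> G v u && (rk u < rk v)%N.
  by case/andP => -> /type_con_rank/rk_lt ->.
apply: (avoiding_of_concessions rk_inj con_back symG irrG) => v /=.
have N0' : 0 < N%:R :> R by rewrite ltr0n.
have d0 : 0 <= (deg G v)%:R :> R by exact: ler0n.
have fN : (size (F v))%:R * N%:R <= (deg G v)%:R * (beta * N%:R) :> R.
  by rewrite mulrA [X in _ <= X * _]mulrC ler_wpM2r // ltW.
case tv: (tau v) => [i [x|w]].
  left; rewrite -(ler_nat R) -(ler_pM2r N0').
  have -> : #|[pred u | con u v]| = #|[pred u | G v u && type_con B (tau u) (i, inl x)]|.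
    by apply: eq_card => u; rewrite !inE /con symG tv.
  apply: le_trans (low v (fun a => type_con B a (i, inl x))).
  apply: le_trans fN _; rewrite [(1 - eta) * _]mulrC -mulrA ler_wpM2l //.
  apply: le_trans hT _; rewrite ler_wpM2l ?subr_ge0 ?(ltW eta1) // ler_nat.
  exact: card_type_granted.
right; rewrite -(ler_nat R) -(ler_pM2r N0').
rewrite [(size _ + _)%:R]natrD [(2 * _)%:R]natrM [(_ + #|back _ _ _|)%:R]natrD !mulrDl -mulrA.
have hj := up v (type_con B (i, inr w)).
have hb := low v [pred b | (type_rank b < type_rank (i, inr w))%N].
have cj := card_type_conceded colB i w.
have cb := card_type_below p i w.
have -> : #|con v| = #|[pred u | G v u && type_con B (i, inr w) (tau u)]|.
  by apply: eq_card => u; rewrite !inE unfold_in /con tv.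
have hback : #|[pred u | G v u
      && (type_rank (tau u) < type_rank (i, inr w : 'I_p + 'I_(2 * s)))%N]|%:R * N%:R
    <= #|back G rk v|%:R * N%:R :> R.
  apply: ler_wpM2r; first exact: ltW.
  rewrite ler_nat; apply: subset_leq_card; apply/subsetP => u.
  by rewrite !inE -tv => /andP[-> /rk_lt].
have nat2 (m n k : nat) : (m * n + k * (2 * s))%N%:R
    = m%:R * n%:R + k%:R * (2 * s%:R) :> R.
  by rewrite natrD (natrM _ m n) (natrM _ k) (natrM _ 2 s).
have YN : K%:R * p%:R + i%:R * (2 * s%:R) <= N%:R :> R.
  by rewrite -nat2 ler_nat card_vtype mulnDr leq_add2l leq_mul2r ltnW ?orbT.
have cjR : #|type_con B (i, inr w)|%:R <= i%:R * s%:R :> R.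
  by rewrite -natrM ler_nat.
have cbR := congr1 (fun n : nat => n%:R : R) cb; rewrite /= nat2 in cbR.
rewrite natrM in hL.
have g0 : 0 <= #|[pred u | con u v]|%:R * N%:R :> R by rewrite mulr_ge0.
(* The error 3 eta N consists of 2 eta N from the doubled upper bound on j and at most eta N from
   the lower bound on b. *)
have key : (deg G v)%:R * (beta * N%:R + 2 * (i%:R * s%:R + eta * N%:R))
    <= (deg G v)%:R * ((1 - eta) * (K%:R * p%:R + i%:R * (2 * s%:R))) :> R.
  have : eta * (K%:R * p%:R + i%:R * (2 * s%:R)) <= eta * N%:R.
    by apply: ler_wpM2l YN; exact: ltW.
  by move=> ?; apply: ler_wpM2l => //; lra.
have cj' : (deg G v)%:R * #|type_con B (i, inr w)|%:R
   <= (deg G v)%:R * (i%:R * s%:R) :> R by exact: ler_wpM2l.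
have hb' : (1 - eta) * (deg G v)%:R * (K%:R * p%:R + i%:R * (2 * s%:R))
    <= #|back G rk v|%:R * N%:R by rewrite -cbR; apply: le_trans hback; exact: hb.
clear - fN hj cj' key hb' g0.
move: #|type_con B (i, inr w)|%:R #|back G rk v|%:R #|[pred u | con u v]|%:R
  #|[pred u | G v u && type_con B (i, inr w) (tau u)]|%:R fN hj cj' key hb' g0.
move=> t1 t2 t3 t4; lra.
Qed.

End Design.

(** * Choice of the parameters *)

Theorem theorem5 (R : realType) (eps : R) (heps : 0 < eps) :
  exists (c : R) (delta0 : nat), 0 < c /\
    forall (V : finType) (G : rel V) (F : V -> set nat),
      simple_graph G ->
      (delta0 <= min_deg G)%N ->
      (max_deg G)%:R <= expR (c * (min_deg G)%:R) ->
      (forall v, finite_set (F v) /\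
         #|` fset_set (F v)|%:R <= (Num.sqrt 2 - 1 - eps) * (deg G v)%:R) ->
      exists D : rel V, orientation G D /\ avoiding F D.
Proof.
(* Half of eps pays for the rational approximation; the other half for [eta] and for the loss of one
   position among K. *)
have [|p [s [p0 ps pps ratio]]] := @exists_sqrt2_ratio R (eps / 2); first by lra.
have [B [rowB colB]] := exists_biregular ps pps.
(* This value gives both eta < 1 and 6 eta <= eps. *)
pose eta : R := eps / (6 * (1 + eps)).
have eta0 : 0 < eta by apply: divr_gt0 => //; lra.
have eta_eps : eta * (6 * (1 + eps)) = eps.
  by rewrite divfK // gt_eqF //; lra.
have eta1 : eta < 1 by nra.
have eta6 : 6 * eta <= eps by nra.
(* Early types are granted only (K - 1) p types instead of K p; K - 1 >= 6 / eps makes the loss at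
   most a sixth of eps. *)
pose K := (Num.bound (6 / eps)).+2.
have K6 : 6 <= eps * (K.-1)%:R.
  rewrite -ler_pdivrMl // mulrC; apply: le_trans (ltW (archi_boundP _)) _.
    by rewrite divr_ge0 // ltW.
  by rewrite ler_nat.
pose T := vtype K p (2 * s).
have N0 : (0 < #|{: T}|)%N by rewrite card_vtype muln_gt0 addn_gt0 p0.
have eta01 : 0 < eta < 1 by rewrite eta0.
have [c [delta0 [c0 equi]]] := exists_equidistributed eta01 N0.
exists c, delta0; split=> // V G F simG d0 maxG hF.
have [tau htau] := equi V G simG.1 d0 maxG.
set M : R := (p + 2 * s)%N%:R in ratio; set th : R := p%:R / M in ratio.
have M0 : 0 < M by rewrite ltr0n addn_gt0 p0.
have pM : p%:R = th * M by rewrite divfK // gt_eqF.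
have th0 : 0 <= th by rewrite divr_ge0 // ltW.
have th1 : th <= 1 by rewrite ler_pdivrMr // mul1r ler_nat leq_addr.
have KK : K%:R = (K.-1)%:R + 1 :> R by rewrite -natr1.
have NM : #|{: T}|%:R = K%:R * M :> R by rewrite card_vtype natrM.
have K0 : 0 <= (K.-1)%:R :> R by [].
have [||v|D [oD aD]] := @avoiding_of_equidistributed R K p s eta
  (Num.sqrt 2 - 1 - eps) B rowB colB V G (fun v => fset_set (F v)) tau simG eta01 N0 _ _ htau.
- rewrite NM natrM pM mulrA [(1 - eta) * _]mulrA [leRHS]mulrA; apply: ler_wpM2r; first exact: ltW.
  rewrite KK; move: ((K.-1)%:R : R) K0 K6 => k K0 K6.
  have h1 : (Num.sqrt 2 - 1 - eps) * (k + 1) <= (th - eps / 2) * (k + 1).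
    by apply: ler_wpM2r; lra.
  have h2 : eta * k * th <= eps / 6 * k.
    have : eta * k * th <= eta * k * 1 by apply: ler_wpM2l => //; rewrite mulr_ge0 // ltW.
    have : eta * k <= eps / 6 * k by apply: ler_wpM2r => //; lra.
    lra.
  nra.
- rewrite NM natrM pM.
  have h1 : (Num.sqrt 2 - 1 - eps + 3 * eta) * (K%:R * M) <= th * (K%:R * M).
    by apply: ler_wpM2r; [rewrite mulr_ge0 // ltW|lra].
  lra.
- exact: (hF v).2.
exists D; split=> // v Fv; move: (aD v); rewrite in_fset_set; last exact: (hF v).1.
by rewrite mem_set.
Qed.
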